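(* (i) For any prime power $q$ and any integers $k,n$ with $1<k<n-1$, there exists an integer $M(q,k,n)$ such that for every $m\geq M(q,k,n)$ there exists a $k$-dimensional linear MRD code in $\mathbb{F}_{q^m}^{n}$ that is not a generalized Gabidulin code. (ii) An integer $M(q,k,n)$ with this property can be taken to be the minimum $m\in\mathbb N$ satisfying $$1-\sum_{r=0}^k r\binom{k}{k-r}_q\binom{n-k}{r}_q q^{r^2}q^{-m}>(m-1)\,q^{-(m-1)(n-k-1)(k-1)} .$$
   Context: $\binom{a}{b}_q$ is the Gaussian binomial coefficient (number of $b$-dimensional subspaces of $\mathbb{F}_q^a$). Fix an $\mathbb{F}_q$-basis $b_1,\dots,b_m$ of $\mathbb{F}_{q^m}$; the rank of $v\in\mathbb{F}_{q^m}^n$ is the rank of the matrix $M\in\mathbb{F}_q^{m\times n}$ with $v_j=\sum_i M_{ij}b_i$, and the rank distance is $d_R(u,v)=\mathrm{rk}(u-v)$. A $k$-dimensional linear code is a $k$-dimensional $\mathbb{F}_{q^m}$-subspace of $\mathbb{F}_{q^m}^n$; it is MRD if its minimum rank distance is $n-k+1$. For $s$ coprime to $m$ and $g_1,\dots,g_n\in\mathbb{F}_{q^m}$ linearly independent over $\mathbb{F}_q$, the generalized Gabidulin code of dimension $k$ with parameter $s$ is the row space of the $k\times n$ matrix with $(i,j)$ entry $g_j^{q^{s(i-1)}}$; a generalized Gabidulin code is such a code for some such $s$ and $g_1,\dots,g_n$. *)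

(* Defs.v *)
From HB Require Import structures.
From mathcomp Require Import all_boot all_order all_algebra all_field.
Set Implicit Arguments. Unset Strict Implicit. Unset Printing Implicit Defensive.
Import Order.TTheory GRing.Theory Num.Theory.
Local Open Scope ring_scope.

(* Gaussian binomial coefficient [a choose b]_q, via the q-Pascal recursion. *)
Fixpoint gbin (q a b : nat) : nat :=
  match a, b with
  | _, 0 => 1
  | 0, _.+1 => 0
  | a'.+1, b'.+1 => (gbin q a' b' + q ^ b * gbin q a' b)%N
  end.

Section RankMetric.
Variables (F : finFieldType) (L : fieldExtType F) (n : nat).

Definition rk (v : 'rV[L]_n) : nat :=
  \rank (\matrix_(i < \dim {:L}, j < n) coord (vbasis {:L}) i (v 0 j)).

Definition rank_dist (u v : 'rV[L]_n) : nat := rk (u - v).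

Definition min_rank_dist (C : {vspace 'rV[L]_n}) (d : nat) : Prop :=
  (forall u v, u \in C -> v \in C -> u != v -> (d <= rank_dist u v)%N) /\
  (exists u v, [/\ u \in C, v \in C, u != v & rank_dist u v = d]).

Definition is_MRD (C : {vspace 'rV[L]_n}) : Prop :=
  min_rank_dist C (n - \dim C + 1).

Definition gab_rows (k s : nat) (g : 'I_n -> L) : seq 'rV[L]_n :=
  [seq \row_(j < n) (g j) ^+ (#|F| ^ (s * i)) | i <- iota 0 k].

Definition gab_code (k s : nat) (g : 'I_n -> L) : {vspace 'rV[L]_n} :=
  <<gab_rows k s g>>%VS.

Definition is_gen_gabidulin (C : {vspace 'rV[L]_n}) : Prop :=
  exists s : nat, coprime s (\dim {:L}) /\
  exists g : 'I_n -> L, free [seq g j | j <- enum 'I_n] /\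
    C = gab_code (\dim C) s g.

End RankMetric.

Definition good_bound (F : finFieldType) (k n M : nat) : Prop :=
  forall m : nat, (M <= m)%N ->
  forall L : fieldExtType F, \dim {:L} = m ->
  exists C : {vspace 'rV[L]_n},
    [/\ \dim C = k, is_MRD C & ~ is_gen_gabidulin C].

Definition bound_ineq (q k n m : nat) : Prop :=
  let qr : rat := q%:R in
  1 - \sum_(0 <= r < k.+1)
        (r%:R * (gbin q k (k - r))%:R * (gbin q (n - k) r)%:R
          * qr ^+ (r * r) * qr ^- m)
  > (m%:R - 1) * qr ^ (- ((m%:Z - 1) * (n%:Z - k%:Z - 1) * (k%:Z - 1))).

(* Main.v *)
(** A uniformly random generator matrix [G] over the field [L] of order
    [Q = q ^ m] works with positive probability.  If [G] fails to generate an MRD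
    code, some nonzero [x] makes [x *m G] a vector of rank at most [n - k], i.e.
    one annihilated by a [k]-dimensional subspace of [F ^ n].  There are
    [gbin q n k] such subspaces, so the fraction of such [G] is at most
    [gbin q n k / (Q - 1)].  By the q-Vandermonde identity this is at most the sum
    in the stated inequality, whose terms carry the extra weights [r].  A
    generalized Gabidulin code is determined by [s] modulo [m] and by [g] up to a
    scalar, hence there are at most [(m - 1) * Q ^ (n - 1)] of them, each with at
    most [Q ^ (k * k)] generator matrices; this is a fraction
    [(m - 1) / Q ^ ((k - 1) * (n - k - 1))]. *)
Require Import Defs.
From HB Require Import structures.
From mathcomp Require Import all_boot all_order all_algebra all_field.
From mathcomp Require Import zify lra.
Set Implicit Arguments. Unset Strict Implicit. Unset Printing Implicit Defensive.
Import Order.TTheory GRing.Theory Num.Theory.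

(** * Gaussian binomials and the numerical inequality *)

Definition wsum (q k n : nat) : nat :=
  \sum_(0 <= r < k.+1)
     r * gbin q k (k - r) * gbin q (n - k) r * q ^ (r * r).

Lemma gbinn0 q a : gbin q a 0 = 1. Proof. by case: a. Qed.

Lemma gbinS q a b : gbin q a.+1 b.+1 = gbin q a b + q ^ b.+1 * gbin q a b.+1.
Proof. by []. Qed.

Lemma gbin_small q a b : a < b -> gbin q a b = 0.
Proof.
elim: a b => [|a IHa] [|b] //= ltab.
by rewrite !IHa ?muln0 // ltnW.
Qed.

Lemma gbinnn q a : gbin q a a = 1.
Proof. by elim: a => //= a ->; rewrite gbin_small // muln0. Qed.

Lemma leq_expn_gbin q a b : 0 < q -> q ^ (b * a) <= gbin q (b + a) b.
Proof.
move=> q0; elim: a b => [|a IHa] b.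
  by rewrite muln0 addn0 gbinnn.
case: b => [|b]; first by rewrite gbinn0.
rewrite addSn gbinS addnS -addSn mulnS expnD.
by apply: leq_trans (leq_addl _ _); rewrite leq_mul2l IHa orbT.
Qed.

Arguments gbin : simpl never.

(** Induction on [a] through the [q]-Pascal rule. The truncated subtraction [a + r - c] is harmless:
    it truncates only when [a < c - r], where [gbin q a (c - r)] vanishes. *)
Lemma gbin_Vandermonde q a b c :
  gbin q (a + b) c =
  \sum_(0 <= r < c.+1) gbin q a (c - r) * gbin q b r * q ^ (r * (a + r - c)).
Proof.
elim: a c => [|a IHa] [|c].
- by rewrite big_nat1 subn0 !gbinn0.
- rewrite big_nat_recr //= big_nat big1 => [|r /andP[_ ltrc]].
    by rewrite subnn gbinn0 !add0n muln0 muln1 mul1n.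
  by rewrite gbin_small // subn_gt0.
- by rewrite big_nat1 subn0 !gbinn0.
rewrite addSn gbinS !IHa [X in _ + _ * X]big_nat_recr //=.
rewrite [RHS]big_nat_recr //= !subnn !gbinn0 mulnDr addnA.
congr (_ + _); last by rewrite mulnCA -expnD !mul1n; congr (_ * q ^ _); lia.
rewrite big_distrr -big_split; apply: eq_big_nat => r /andP[_ ltrc] /=.
rewrite subSn // gbinS 2!mulnDl addSn subSS; congr (_ + _).
have [ltac | lecra] := ltnP a (c - r).+1.
  by rewrite gbin_small // ?muln0 ?mul0n.
set X := gbin q a _; set Y := gbin q b r.
have eq_exp : c.+1 + r * (a + r - c.+1) = (c - r).+1 + r * (a + r - c) by nia.
by rewrite mulnCA -expnD eq_exp expnD mulnCA !mulnA.
Qed.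

(** Vandermonde gives the same terms without the weights [r]. The weight [0] loses only the term [1]
    at [r = 0], while the term at [r = 2], which exceeds [1], is counted twice. *)
Lemma gbin_lt_wsum q k n : 1 < q -> 1 < k -> k.+1 < n ->
  gbin q n k < wsum q k n.
Proof.
move=> q1 k1 kn; rewrite -{1}(subnKC (ltnW (ltnW kn))) gbin_Vandermonde /wsum.
case: k k1 kn => [|[|k]] // _ kn.
set x := n - k.+2.
rewrite 3?big_nat_recl // ![in ltnRHS]big_nat_recl //.
set A := \sum_(0 <= _ < _) _; set B := \sum_(0 <= _ < _) _.
have leAB : A <= B.
  apply: leq_sum => r _; rewrite addnC addnK -!mulnA.
  by rewrite -[leqLHS]mul1n leq_mul.
have q0 : 0 < q by apply: ltnW.
have pos u v : v <= u -> 0 < gbin q u v.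
  move=> vu; rewrite -(subnKC vu); apply: leq_trans (leq_expn_gbin _ _ q0).
  by rewrite expn_gt0 q0.
have x2 : 1 < gbin q k.+2 (k.+2 - 2) * gbin q x 2 * q ^ (2 * 2).
  apply: (@leq_mul 1 2); first by rewrite muln_gt0 !pos ?leq_subr // /x; lia.
  by rewrite (leq_trans q1) // -[leqLHS]expn1 leq_exp2l.
rewrite !addKn subn0 gbinnn gbinn0 !mul0n !mul1n; move: x2; rewrite -!mulnA.
set z := _ * (_ * q ^ (2 * 2)); lia.
Qed.

Local Open Scope ring_scope.

Lemma bound_ineqE q k n m : (1 < k)%N -> (k.+1 < n)%N ->
  bound_ineq q k n m <->
  (m%:R - 1) * (q%:R : rat) ^ (- ((m%:Z - 1) * ((n - k - 1) * (k - 1))%N%:Z))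
    < 1 - (wsum q k n)%:R / q%:R ^+ m.
Proof.
move=> k1 kn; rewrite /bound_ineq /wsum natr_sum mulr_suml.
have -> : (n%:Z - k%:Z - 1) = (n - k - 1)%N%:Z by lia.
have -> : (k%:Z - 1) = (k - 1)%N%:Z by lia.
rewrite -mulrA -PoszM.
by under eq_bigr do rewrite -natrX -!natrM.
Qed.

(* The product of the bound with [q ^ m * q ^ (m * c)], where the factor
   [q ^ (m - 1)] in the denominator has been weakened to [q ^ m]. *)
Lemma bound_ineq_nat q k n M m : (1 < q)%N -> (1 < k)%N -> (k.+1 < n)%N ->
  bound_ineq q k n M -> (M <= m)%N ->
  let T := wsum q k n in let Q := (q ^ m)%N in
  let c := ((n - k - 1) * (k - 1))%N in
  [/\ (1 < m)%N, (T < Q)%N & ((m - 1) * Q < (Q - T) * Q ^ c)%N].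
Proof.
move=> q1 k1 kn /bound_ineqE-/(_ k1 kn) + leMm T Q c.
rewrite -/T -/c => bM.
have q0 : 0 < q%:R :> rat by rewrite ltr0n; lia.
have c0 : (0 < c)%N by rewrite muln_gt0; lia.
have gT : (q ^ (k * (n - k)) < T)%N.
  apply: leq_ltn_trans (gbin_lt_wsum q1 k1 kn).
  rewrite -{2}(subnKC (ltnW (ltnW kn))); apply: leq_expn_gbin; lia.
have lecT : (q ^ c < T)%N.
  apply: leq_ltn_trans gT; rewrite leq_exp2l // /c; nia.
have ltqT : (q < T)%N.
  by apply: leq_ltn_trans lecT; rewrite -{1}(expn1 q) leq_exp2l.
(* For [M = 0] the inequality reads [T < 1 + q ^ c], for [M = 1] it reads [T < q]; both contradict
   the lower bounds on [T]. *)
have M1 : (1 < M)%N.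
  case: M bM {leMm} => [|[|M]] //.
    rewrite expr0 divr1 !sub0r mulN1r opprK -exprnP -natrX muln1 => h.
    have: (T%:R < 1 + (q ^ c)%:R :> rat) by lra.
    by rewrite addrC natr1 ltr_nat ltnS leqNgt lecT.
  rewrite subrr !mul0r subr_gt0 expr1 ltr_pdivrMr // mul1r ltr_nat.
  by rewrite ltnNge ltnW.
case: M M1 leMm bM => // M M1 leMm; case: m @Q leMm => // m Q leMm.
have -> : M.+1%:Z - 1 = M%:Z by lia.
rewrite -natr1 addrK -PoszM -exprnN -!natrX => bM.
have Q0 : (0 < Q)%N by rewrite expn_gt0; lia.
have leQ : (q ^ M.+1 <= Q)%N by rewrite leq_exp2l.
(* [m] and [M] are now the predecessors of the original values. As [x / q ^ (x * c)] is
   nonincreasing for [x >= 1], the inequality passes from [M] to every larger [m]. *)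
have decr : (m * q ^ (M * c) <= M * q ^ (m * c))%N.
  move: leMm; rewrite ltnS => leMm.
  rewrite -(subnK leMm); elim: (m - M)%N => // i IH.
  rewrite addSn mulSn expnD.
  have: (2 <= q ^ c)%N by rewrite (leq_trans q1) // -[leqLHS]expn1 leq_exp2l.
  set u := (q ^ c)%N; set v := (q ^ _)%N in IH *; set w := (q ^ _)%N in IH *.
  nia.
have lt1 : (m%:R / (q ^ (m * c))%:R < 1 - T%:R / Q%:R :> rat).
  apply: le_lt_trans (lt_le_trans bM _).
    rewrite ler_pdivrMr ?ltr0n ?expn_gt0; last by lia.
    rewrite mulrAC ler_pdivlMr ?ltr0n ?expn_gt0; last by lia.
    by rewrite -!natrM ler_nat.
  rewrite lerD2l lerN2 ler_wpM2l // lef_pV2 ?posrE ?ltr0n ?ler_nat //.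
  by rewrite expn_gt0; lia.
have ltTQ : (T < Q)%N.
  rewrite -(ltr_nat rat) -[ltRHS]mul1r -ltr_pdivrMr ?ltr0n // -subr_gt0.
  by apply: le_lt_trans lt1; rewrite divr_ge0.
split=> //; first by lia.
rewrite subSS subn0 -(ltr_nat rat) !natrM natrB ?(ltnW ltTQ) //.
move: lt1; rewrite ltr_pdivrMr ?ltr0n ?expn_gt0; last by lia.
move=> lt1.
have Qr : 0 < Q%:R :> rat by rewrite ltr0n.
rewrite -(ltr_pM2r Qr) in lt1; apply: lt_le_trans lt1 _.
rewrite mulrAC mulrBl mul1r divfK ?gt_eqF // ler_wpM2l //.
  by rewrite subr_ge0 ler_nat ltnW.
by rewrite ler_nat -expnM leq_exp2l // leq_mul2r leqnSn orbT.
Qed.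

Lemma bound_ineq_ex q k n : (1 < q)%N -> (1 < k)%N -> (k.+1 < n)%N ->
  exists M, bound_ineq q k n M.
Proof.
(* At [m = T + 3] both [(m - 1) / q ^ ((m - 1) * c)] and [T / q ^ m] are below [1/2], because
   [T < 2 ^ T]. *)
move=> q1 k1 kn; exists (wsum q k n).+3; apply/bound_ineqE => //.
set T := wsum _ _ _; set c := ((n - k - 1) * (k - 1))%N.
have c0 : (0 < c)%N by rewrite muln_gt0; lia.
have -> : T.+3%:Z - 1 = T.+2%:Z by lia.
rewrite -natr1 addrK -PoszM -exprnN -!natrX.
have le2 e : (2 ^ e <= q ^ e)%N by case: e => [|e]; rewrite ?expn0 ?leq_exp2r.
have half (u v : nat) : (2 * u < v)%N -> (u%:R / v%:R < 2^-1 :> rat).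
  move=> h; rewrite ltr_pdivrMr ?ltr0n; last by lia.
  rewrite mulrC ltr_pdivlMr // -natrM ltr_nat; lia.
have exp2 e : (e < 2 ^ e)%N by exact: ltn_expl.
have h1 : (2 * T.+2 < q ^ (T.+2 * c))%N.
  have T0 : (0 < T)%N by apply: leq_trans (gbin_lt_wsum q1 k1 kn).
  apply: (@leq_trans (2 ^ T.+2)); first by rewrite !expnS; have := exp2 T; lia.
  by apply: leq_trans (le2 _) _; rewrite leq_exp2l // leq_pmulr.
have h2 : (2 * T < q ^ T.+3)%N.
  apply: leq_trans (le2 _); rewrite !expnS; have := exp2 T; lia.
have := half _ _ h1; have := half _ _ h2; lra.
Qed.

(** * Enumeration of subspaces by row-free matrices *)

(* Every subspace of dimension [b] in [F ^ a.+1] either projects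
   isomorphically along the first coordinate, and is the graph of one of
   [#|F| ^ b] linear forms over its image, or contains the first basis vector;
   this is the [q]-Pascal recursion. *)
Lemma gbin_row_spaces (F : finFieldType) (a b : nat) :
  exists2 s : seq 'M[F]_(b, a), size s = gbin #|F| a b &
  forall p (A : 'M_(p, a)), (b <= \rank A)%N ->
    exists E, [/\ E \in s, row_free E & (E <= A)%MS].
Proof.
elim: a b => [|a IHa] [|b].
- by exists [:: 0] => // p A _; exists 0; rewrite mem_head sub0mx /row_free mxrank0.
- exists [::] => // p A /leq_trans/(_ (rank_leq_col _)); by rewrite ltn0.
- exists [:: 0] => // p A _; exists 0.
  by rewrite mem_head sub0mx /row_free mxrank0.
have [s1 sz1 h1] := IHa b.+1; have [s2 sz2 h2] := IHa b.
pose E1 (cE : 'cV[F]_b.+1 * 'M[F]_(b.+1, a)) : 'M[F]_(b.+1, 1 + a) :=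
  row_mx cE.1 cE.2.
pose E2 (E : 'M[F]_(b, a)) : 'M[F]_(1 + b, 1 + a) := block_mx 1%:M 0 0 E.
exists ([seq E2 E | E <- s2] ++ [seq E1 (c, E) | c <- enum 'cV[F]_b.+1, E <- s1]).
  rewrite size_cat size_map size_allpairs sz1 sz2 -cardE card_mx.
  by rewrite muln1.
move=> p; rewrite -[a.+1]/(1 + a)%N => A rkA.
have [c [A' defA]] : exists c A', A = row_mx (c : 'cV_p) (A' : 'M_(p, a)).
  by exists (lsubmx A), (rsubmx A); rewrite hsubmxK.
have [rkA'|] := ltnP b (\rank A').
  have [E [Es1 freeE /submxP[D defE]]] := h1 _ _ rkA'.
  exists (row_mx (D *m c) E); split.
  - rewrite mem_cat; apply/orP; right; apply/allpairsP.
    by exists (D *m c, E); split=> //; rewrite mem_enum.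
  - rewrite -row_leq_rank; apply: leq_trans (mxrankM_maxl _ (col_mx 0 1%:M)) => //.
    by rewrite mul_row_col mulmx0 mulmx1 add0r row_leq_rank.
  - by rewrite defA defE -mul_mx_row submxMl.
move=> rkA'.
have rkA'b : (b <= \rank A')%N.
  rewrite -ltnS; apply: leq_trans rkA _.
  rewrite defA -mxrank_tr tr_row_mx -addsmxE -(mxrank_tr A').
  apply: leq_trans (mxrank_adds_leqif _ _) _.
  by rewrite -[leqRHS]add1n leq_add2r rank_leq_row.
(* [A] has larger rank than [A'], so [kermx A'] is not inside [kermx A]: the row space of [A]
   contains a nonzero multiple of the first basis vector. *)
have [v vA' vc] : exists2 v : 'rV_p, v *m A' = 0 & v *m c != 0.
  have [kc|] := eqVneq (kermx A' *m c) 0.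
    have: (kermx A' <= kermx A)%MS.
      by apply/sub_kermxP; rewrite defA mul_mx_row kc mulmx_ker row_mx0.
    move=> /mxrankS; rewrite !mxrank_ker leqNgt ltn_sub2l //.
      by apply: leq_ltn_trans rkA' (leq_trans rkA (rank_leq_row _)).
    exact: leq_ltn_trans rkA' rkA.
  case/rowV0Pn=> w /submxP[D ->] Dn0; exists (D *m kermx A').
    by rewrite -mulmxA mulmx_ker mulmx0.
  by rewrite -mulmxA.
wlog {vc} vc : v vA' / v *m c = 1%:M => [wlog_v|].
  pose x := (v *m c) 0 0.
  have defx : v *m c = x%:M by rewrite [LHS]mx11_scalar.
  have x0 : x != 0 by apply: contraNneq vc => x0; rewrite defx x0 raddf0.
  apply: (wlog_v (x^-1 *: v)); rewrite -scalemxAl ?vA' ?scaler0 //.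
  by rewrite defx scale_scalar_mx mulVf.
have [E [Es2 freeE /submxP[D defE]]] := h2 _ _ rkA'b.
exists (E2 E); split.
- by rewrite mem_cat map_f.
- have rkE2 : \rank (E2 E) = (1 + \rank E)%N.
    by rewrite /E2 rank_diag_block_mx mxrank1.
  by rewrite -row_leq_rank rkE2 add1n ltnS row_leq_rank.
- have -> : E2 E = col_mx v (D - (D *m c) *m v) *m A; last exact: submxMl.
  rewrite defA mul_col_row vA' vc !mulmxBl -!mulmxA vc vA' mulmx1 !mulmx0.
  by rewrite subrr subr0 -defE.
Qed.

Lemma leq_card_seq_cover (T : finType) (I : eqType) (s : seq I)
    (X : I -> {set T}) (S : {set T}) (b : nat) :
  (forall x, x \in S -> exists2 i, i \in s & x \in X i) ->
  (forall i, (#|X i| <= b)%N) -> (#|S| <= size s * b)%N.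
Proof.
move=> coverS leXb; elim: s S coverS => [|i s IHs] S coverS.
  rewrite leqn0 cards_eq0; apply/eqP/setP=> x; rewrite inE.
  by apply/negP=> /coverS[].
rewrite mulSn -(cardsID (X i) S) leq_add //.
  by apply: leq_trans (leXb i); rewrite subset_leq_card ?subsetIr.
apply: IHs => x; rewrite inE => /andP[xNXi /coverS[j]].
by rewrite inE => /predU1P[-> xXi|js xXj]; [rewrite xXi in xNXi | exists j].
Qed.

(** * Counting bad generator matrices over a finite field *)

Section Count.
Variable K : finFieldType.

(** If [x 0 i != 0], row [i] of [G] can be recovered from [x *m G] and the other rows. *)
Lemma card_mulmx_row_mem k n (S : {set 'rV[K]_n}) (x : 'rV[K]_k) : x != 0 ->
  (#|[set G : 'M[K]_(k, n) | x *m G \in S]| <= #|S| * #|K| ^ (k.-1 * n))%N.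
Proof.
case/rV0Pn=> i xi.
rewrite -card_mx -cardsT -cardsX.
pose f (G : 'M[K]_(k, n)) := (x *m G, row' i G).
have f_inj : injective f.
  move=> G H [eqx eqr].
  have eqj j : j != i -> row j G = row j H.
    rewrite eq_sym => /unlift_some[j' -> _].
    by apply/rowP=> l; move/matrixP/(_ j' l): eqr; rewrite !mxE.
  apply/row_matrixP=> j; have [->|/eqj //] := eqVneq j i.
  move: eqx; rewrite !mulmx_sum_row (bigD1 i) //= [RHS](bigD1 i) //=.
  rewrite (eq_bigr (fun j => x 0 j *: row j H)) => [|l /eqj-> //].
  by move/addIr/(scalerI xi).
rewrite -(card_imset _ f_inj) subset_leq_card //; apply/subsetP=> y.
by case/imsetP=> G; rewrite inE => GS ->; rewrite !inE GS.
Qed.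

(** The condition is on [x], not on [x *m G]: when [S] contains [0], avoiding [S] also forces the
    rows of [G] to be free. *)
Definition code_meets k n (S : {set 'rV[K]_n}) (G : 'M[K]_(k, n)) : bool :=
  [exists x : 'rV[K]_k, (x != 0) && (x *m G \in S)].

(* Double counting of the pairs [(x, G)]: each bad [G] has a whole punctured
   line of witnesses [x]. *)
Lemma card_generator_meet k n (S : {set 'rV[K]_n}) :
  (forall a v, v \in S -> a *: v \in S) ->
  (#|K|.-1 * #|[set G : 'M[K]_(k, n) | code_meets S G]|
    <= #|K| ^ k * (#|S| * #|K| ^ (k.-1 * n)))%N.
Proof.
move=> scalS; set B := [set G | _].
pose P (x : 'rV[K]_k) (G : 'M[K]_(k, n)) := (x != 0) && (x *m G \in S).
apply: (@leq_trans (\sum_(G in B) #|[set x | P x G]|)).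
  rewrite mulnC -sum_nat_const; apply: leq_sum => G.
  rewrite inE => /existsP[x /andP[x0 xS]].
  have line_inj : injective (fun a : K => a *: x).
    move=> a b /eqP; rewrite -subr_eq0 -scalerBl scaler_eq0 (negPf x0) orbF.
    by rewrite subr_eq0 => /eqP.
  rewrite -(cardC1 (0 : K)) -(card_image line_inj); apply: subset_leq_card.
  apply/subsetP=> y /imageP[a]; rewrite !inE /P => a0 ->.
  by rewrite scaler_eq0 negb_or a0 x0 -scalemxAl scalS.
rewrite [leqLHS](_ : _ = \sum_(x : 'rV[K]_k) #|[set G in B | P x G]|); last first.
  under eq_bigr do rewrite -sum1dep_card; rewrite (exchange_big_dep xpredT) //=.
  by apply: eq_bigr => x _; rewrite -sum1dep_card.
apply: (@leq_trans (\sum_(x : 'rV[K]_k) #|S| * #|K| ^ (k.-1 * n))); last first.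
  by rewrite sum_nat_const card_mx mul1n.
apply: leq_sum => x _; have [->|x0] := eqVneq x 0.
  rewrite (_ : [set _ in _ | _] = set0) ?cards0 //.
  by apply/setP=> G; rewrite !inE /P eqxx andbF.
apply: leq_trans (card_mulmx_row_mem _ x0); apply: subset_leq_card.
by apply/subsetP=> G; rewrite !inE => /andP[_ /andP[]].
Qed.

Lemma card_kermx k n (B : 'M[K]_(n, k)) :
  (#|[set v : 'rV[K]_n | (v *m B == 0)%R]| <= #|K| ^ (n - \rank B))%N.
Proof.
rewrite -mxrank_ker -[X in (_ ^ X)%N]mul1n -card_mx.
pose f (D : 'rV[K]_(\rank (kermx B))) := D *m row_base (kermx B).
apply: leq_trans (leq_imset_card f _); apply: subset_leq_card.
apply/subsetP=> v; rewrite inE -sub_kermx -(eq_row_base (kermx B)).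
by case/submxP=> D ->; apply/imsetP; exists D.
Qed.

Definition gab_mx (q k s n : nat) (g : 'rV[K]_n) : 'M[K]_(k, n) :=
  \matrix_(i, j) g 0 j ^+ (q ^ (s * i)).

(** The successor makes the parameter range over [1 <= s < m], and [g] is normalised to first entry
    [1]. A superset of the Gabidulin generator matrices is enough for an upper bound. *)
Definition gab_generators (q m k n : nat) : {set 'M[K]_(k, 1 + n)} :=
  [set Ath.1 *m gab_mx q k Ath.2.1.+1 (row_mx 1%:M Ath.2.2)
     | Ath : 'M[K]_k * ('I_m.-1 * 'rV[K]_n)].

Lemma card_gab_generators q m k n :
  (#|gab_generators q m k n| <= #|K| ^ (k * k) * (m.-1 * #|K| ^ n))%N.
Proof.
apply: leq_trans (leq_imset_card _ _) _.
by rewrite !card_prod card_ord !card_mx mul1n.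
Qed.

(** Raising to the power [q ^ m = #|K|] is the identity on [K]. *)
Lemma gab_mx_modn q m k s n (g : 'rV[K]_n) :
  #|K| = (q ^ m)%N -> gab_mx q k (s %% m) g = gab_mx q k s g.
Proof.
move=> cardK; apply/matrixP=> i j; rewrite !mxE.
rewrite {2}(divn_eq s m) mulnDl expnD exprM; congr (_ ^+ _).
rewrite mulnAC mulnC expnM -cardK.
by elim: (_ * _)%N => // e IH; rewrite expnS exprM expf_card.
Qed.

(* Scaling [g] by a constant rescales the rows of its matrix, and [s] only
   matters modulo [m]. *)
Lemma mem_gab_generators q m k s n (g : 'rV[K]_(1 + n)) (A : 'M[K]_k) :
  #|K| = (q ^ m)%N -> (1 < m)%N -> coprime s m -> g 0 0 != 0 ->
  A *m gab_mx q k s g \in gab_generators q m k n.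
Proof.
move=> cardK m1 co_sm g0; rewrite -(gab_mx_modn _ _ _ cardK).
(* Coprimality with [m > 1] excludes residue [0], so the residue is a successor, as the indexing by
   ['I_m.-1] requires. *)
have t0 : (0 < s %% m)%N.
  rewrite lt0n; apply: contraL co_sm => /eqP s0.
  by rewrite -coprime_modl s0 /coprime gcd0n gtn_eqF.
have ltt : ((s %% m).-1 < m.-1)%N.
  by rewrite -ltnS !prednK ?ltn_mod // ltnW.
pose h : 'rV_n := \row_j (g 0 (rshift 1 j) / g 0 0).
pose d : 'rV_k := \row_i g 0 0 ^+ (q ^ (s %% m * i)).
apply/imsetP; exists (A *m diag_mx d, (Ordinal ltt, h)) => //=.
rewrite prednK // -mulmxA; congr (_ *m _).
apply/matrixP=> i j; rewrite mul_diag_mx !mxE -exprMn; congr (_ ^+ _).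
case: splitP => j' jj'; rewrite mxE.
  rewrite ord1 mulr1; congr (g 0 _); apply/val_inj; by rewrite /= jj' ord1.
by rewrite mulrCA mulfV // mulr1; congr (g 0 _); apply/val_inj.
Qed.

End Count.

(** * Rank over the base field *)

Section Rank.
Variables (F : finFieldType) (L : fieldExtType F) (n : nat).

Definition coord_mx (v : 'rV[L]_n) : 'M[F]_(\dim {:L}, n) :=
  \matrix_(i, j) coord (vbasis {:L}) i (v 0 j).

(** Multiplication by [a] is [F]-linear on [L]; the left factor is its matrix in [vbasis]. Hence
    scaling cannot raise the rank. *)
Lemma coord_mxZ (a : L) (v : 'rV[L]_n) :
  coord_mx (a *: v) =
  (\matrix_(i, l) coord (vbasis {:L}) i (a * (vbasis {:L})`_l)) *m coord_mx v.
Proof.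
apply/matrixP=> i j; rewrite !mxE {1}(coord_vbasis (memvf (v 0 j))).
rewrite mulr_sumr linear_sum; apply: eq_bigr => l _.
by rewrite !mxE -scalerAr linearZ; apply: mulrC.
Qed.

Lemma rkZ_le (a : L) (v : 'rV[L]_n) : (rk (a *: v) <= rk v)%N.
Proof. by rewrite /rk -/(coord_mx _) coord_mxZ mxrankM_maxr. Qed.

Lemma rk0 : rk (0 : 'rV[L]_n) = 0%N.
Proof.
apply/eqP; rewrite mxrank_eq0; apply/eqP/matrixP=> i j.
by rewrite !mxE linear0.
Qed.

(** Since [E] has entries in [F], it commutes with taking coordinates; a rank defect of [v] thus
    becomes a linear condition over [L]. *)
Lemma mulmx_coord0 k (E : 'M[F]_(k, n)) (v : 'rV[L]_n) :
  E *m (coord_mx v)^T = 0 -> v *m (map_mx (in_alg L) E)^T = 0.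
Proof.
move=> Ev; apply/rowP=> i; rewrite !mxE.
transitivity (\sum_l (E *m (coord_mx v)^T) i l *: (vbasis {:L})`_l); last first.
  by rewrite Ev big1 // => l _; rewrite mxE scale0r.
under [RHS]eq_bigr do rewrite mxE scaler_suml; rewrite exchange_big /=.
apply: eq_bigr => j _; rewrite !mxE mulr_algr.
rewrite {1}(coord_vbasis (memvf (v 0 j))) scaler_sumr.
by apply: eq_bigr => l _; rewrite !mxE scalerA.
Qed.

Lemma rk_zero_cols (v : 'rV[L]_n) r : (r <= n)%N ->
  (forall j : 'I_n, (j < r)%N -> v 0 j = 0) -> (rk v <= n - r)%N.
Proof.
move=> lern v0; rewrite /rk -/(coord_mx v) -(rank_copid_mx F lern).
suff -> : coord_mx v = coord_mx v *m copid_mx r by apply: mxrankM_maxr.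
rewrite mulmxBr mulmx1 -[LHS]subr0; congr (_ - _).
apply/matrixP=> i j; rewrite !mxE big1 // => l _; rewrite !mxE.
have [/v0->|] := ltnP l r; first by rewrite linear0 mul0r.
by rewrite andbF mulr0.
Qed.

End Rank.

(** * The union bound, with denominators cleared *)

Lemma exists_generator (K : finFieldType) (k n : nat)
    (S : {set 'rV[K]_n}) (B : {set 'M[K]_(k, n)}) :
  (forall a v, v \in S -> a *: v \in S) ->
  (#|K| ^ k * (#|S| * #|K| ^ (k.-1 * n)) + #|K|.-1 * #|B|
     < #|K|.-1 * #|K| ^ (k * n))%N ->
  exists2 G, G \notin B & ~~ code_meets S G.
Proof.
move=> scalS lt_card.
pose bad := [set G : 'M[K]_(k, n) | code_meets S G] :|: B.
have [G GNbad] : exists G, G \notin bad.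
  apply/existsP; rewrite -negb_forall; apply: contraL lt_card => /forallP all_bad.
  rewrite -leqNgt -(card_mx K k n).
  have -> : #|{: 'M[K]_(k, n)}| = #|bad| by apply: eq_card => G; rewrite all_bad.
  apply: leq_trans
    (_ : #|K|.-1 * (#|[set G : 'M[K]_(k, n) | code_meets S G]| + #|B|) <= _)%N.
    by rewrite leq_mul2l leq_card_setU orbT.
  by rewrite mulnDr leq_add2r card_generator_meet.
move: GNbad; rewrite !inE negb_or => /andP[GS GB]; by exists G.
Qed.

(** The key is [N * Q <= T * (Q - 1)], true as [N <= T - 1] and [T < Q]: the strict gap between [N]
    and [T] pays for dividing by [Q - 1] instead of [Q]. *)
Lemma generator_count (Q T N W m : nat) :
  (N < T -> T < Q -> (m - 1) * Q < (Q - T) * W ->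
   N * W + Q.-1 * (m - 1) < Q.-1 * W)%N.
Proof.
move=> NT TQ h.
have [Q' defQ] : exists Q', Q = (Q' + T.+1)%N by exists (Q - T.+1)%N; lia.
have [T' defT] : exists T', T = (T' + N.+1)%N by exists (T - N.+1)%N; lia.
have -> : (Q.-1 = Q' + T)%N by lia.
have eQT : (Q - T = Q'.+1)%N by lia.
rewrite eQT in h; set p := (m - 1)%N in h *.
rewrite -(ltn_pmul2r (_ : 0 < Q)%N); last by lia.
have h2 : ((Q' + T) * (p * Q) < (Q' + T) * (Q'.+1 * W))%N by rewrite ltn_pmul2l; lia.
suff : ((Q' + T) * (Q'.+1 * W) + N * W * Q <= (Q' + T) * W * Q)%N by nia.
suff : ((Q' + T) * Q'.+1 + N * Q <= (Q' + T) * Q)%N by nia.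
nia.
Qed.

(** * From generator matrices to codes over the extension field *)

Section Main.
Variables (F : finFieldType) (L : fieldExtType F).
Let K : finFieldType := FinFieldExtType L.

Lemma card_finExt : #|K| = (#|F| ^ \dim {:L})%N.
Proof.
by rewrite -(card_vspace (T := K)) card_vspacef.
Qed.

Definition low_rank (n r : nat) : {set 'rV[K]_n} :=
  [set v : 'rV[K]_n | (rk (v : 'rV[L]_n) <= r)%N].

Lemma card_low_rank n k : (k <= n)%N ->
  (#|low_rank n (n - k)| <= gbin #|F| n k * #|K| ^ (n - k))%N.
Proof.
move=> lekn; have [s <- sP] := gbin_row_spaces F n k.
(* The covering bound must hold for every [E], and a matrix that is not row-free could have too
   large a kernel; it gets the empty set. *)
pose X (E : 'M[F]_(k, n)) : {set 'rV[K]_n} :=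
  if row_free E then
    [set v : 'rV[K]_n | (v *m (map_mx (in_alg L) E : 'M[K]_(k, n))^T == 0)%R]
  else set0.
apply: (@leq_card_seq_cover _ _ s X) => [v|E].
  rewrite inE => rkv.
  have [|E [Es freeE /sub_kermxP Ev]] := sP n (kermx (coord_mx (v : 'rV[L]_n))^T).
    by rewrite mxrank_ker mxrank_tr; move: rkv; rewrite /rk -/(coord_mx _); lia.
  by exists E => //; rewrite /X freeE inE; apply/eqP/mulmx_coord0.
rewrite /X; case: ifP => [freeE|_]; last by rewrite cards0.
apply: leq_trans (card_kermx _) _.
rewrite mxrank_tr (mxrank_map (in_alg L)).
by move: freeE; rewrite /row_free => /eqP->.
Qed.

Lemma row_span_memP k n (G : 'M[L]_(k, n)) v :
  reflect (exists x : 'rV_k, v = x *m G) (v \in <<[tuple row i G | i < k]>>%VS).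
Proof.
apply: (iffP idP) => [/coord_span->|[x ->]].
  exists (\row_i coord [tuple row i G | i < k] i v).
  rewrite mulmx_sum_row; apply: eq_bigr => i _.
  by rewrite mxE -tnth_nth tnth_mktuple.
rewrite mulmx_sum_row; apply: rpred_sum => i _; apply/rpredZ/memv_span.
by apply/tnthP; exists i; rewrite tnth_mktuple.
Qed.

Lemma row_span_dim k n (G : 'M[L]_(k, n)) :
  (forall x : 'rV_k, x *m G = 0 -> x = 0) ->
  \dim <<[tuple row i G | i < k]>>%VS = k.
Proof.
move=> injG; suff: free [tuple row i G | i < k].
  by rewrite /free size_tuple => /eqP.
apply/freeP=> c c0 i.
have /injG/rowP/(_ i) : (\row_j c j) *m G = 0.
  rewrite mulmx_sum_row -[RHS]c0; apply: eq_bigr => j _.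
  by rewrite mxE -tnth_nth tnth_mktuple.
by rewrite !mxE.
Qed.

Lemma row_span_MRD k n (G : 'M[L]_(k, n)) : (0 < k <= n)%N ->
  (forall x : 'rV_k, x != 0 -> (n - k < rk (x *m G))%N) ->
  let C := <<[tuple row i G | i < k]>>%VS in \dim C = k /\ is_MRD C.
Proof.
move=> /andP[k0 lekn] rkG C.
have dimC : \dim C = k.
  apply: row_span_dim => x xG0; apply/eqP; apply: contraT => /rkG.
  by rewrite xG0 rk0.
have dist u v : u \in C -> v \in C -> u != v -> (n - k + 1 <= rank_dist u v)%N.
  move=> /row_span_memP[x ->] /row_span_memP[y ->] neq.
  rewrite /rank_dist -mulmxBl addn1 rkG // subr_eq0.
  by apply: contra_neq neq => ->.
split=> //; rewrite /is_MRD dimC; split=> //.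
have lek1n : (k.-1 <= n)%N by apply: leq_trans (leq_pred k) lekn.
pose G1 : 'M_(k, k.-1) := colsub (widen_ord lek1n) G.
(* Singleton argument: [k - 1] equations in [k] unknowns give a nonzero codeword vanishing on the
   first [k - 1] coordinates, so of rank at most [n - k + 1]. *)
have [x xG1 x0] : exists2 x : 'rV_k, x *m G1 = 0 & x != 0.
  have /rowV0Pn[x /sub_kermxP xG1 x0] : kermx G1 != 0.
    by rewrite kermx_eq0 /row_free neq_ltn (leq_ltn_trans (rank_leq_col _)) ?prednK.
  by exists x.
exists (x *m G), 0; rewrite mem0v.
have xGC : x *m G \in C by apply/row_span_memP; exists x.
have xG0 : x *m G != 0 by apply: contraTneq (rkG _ x0) => ->; rewrite rk0.
split=> //; apply/eqP; rewrite eqn_leq dist ?mem0v // andbT /rank_dist subr0.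
have -> : (n - k + 1 = n - k.-1)%N by lia.
apply: rk_zero_cols => // j ltj.
have /rowP/(_ (Ordinal ltj)) := xG1; rewrite mulmx_colsub !mxE => {2}<-.
by apply: eq_bigr => l _; congr (_ * G l _); apply/val_inj.
Qed.

Lemma gab_code_generators k n (G : 'M[L]_(k, 1 + n)) :
  let C := <<[tuple row i G | i < k]>>%VS in
  (1 < \dim {:L})%N -> \dim C = k -> is_gen_gabidulin C ->
  (G : 'M[K]_(k, 1 + n)) \in gab_generators K #|F| (\dim {:L}) k n.
Proof.
move=> C m1 dimC [s [co_sm [g [free_g]]]]; rewrite dimC => defC.
pose gv : 'rV[K]_(1 + n) := \row_j g j.
have gab_rowE : gab_rows k s g = [tuple row i (gab_mx #|F| k s gv) | i < k].
  rewrite /gab_rows -val_enum_ord -map_comp; apply: eq_map => i /=.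
  by apply/rowP=> j; rewrite !mxE.
have rowG i : exists x : 'rV[L]_k, row i G == x *m gab_mx #|F| k s gv.
  have : row i G \in C by apply/row_span_memP; exists (delta_mx 0 i); rewrite rowE.
  rewrite defC /gab_code gab_rowE => /row_span_memP[x ->]; by exists x.
pose A : 'M[K]_k := \matrix_i xchoose (rowG i).
have -> : G = A *m gab_mx #|F| k s gv.
  by apply/row_matrixP=> i; rewrite row_mul rowK; apply/eqP/(xchooseP (rowG i)).
apply: mem_gab_generators => //; first exact: card_finExt.
(* Freeness of [g] makes its first entry nonzero, which permits the normalisation. *)
rewrite mxE; apply: (free_not0 free_g); apply: map_f; exact: mem_enum.
Qed.

Lemma exists_MRD_not_gabidulin k n (m := \dim {:L}) (Q := (#|F| ^ m)%N)
    (T := wsum #|F| k n) :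
  (1 < k)%N -> (k.+1 < n)%N -> (1 < m)%N -> (T < Q)%N ->
  ((m - 1) * Q < (Q - T) * Q ^ ((n - k - 1) * (k - 1)))%N ->
  exists C : {vspace 'rV[L]_n}, [/\ \dim C = k, is_MRD C & ~ is_gen_gabidulin C].
Proof.
case: n @T => // n T k1 kn m1 ltTQ count.
have F1 : (1 < #|F|)%N := finNzRing_gt1 F.
pose S := low_rank n.+1 (n.+1 - k); pose B := gab_generators K #|F| m k n.
have scalS a v : v \in S -> a *: v \in S.
  by rewrite !inE; apply: leq_trans; apply: rkZ_le.
have lekn : (k <= n.+1)%N by lia.
have cardS := card_low_rank lekn.
have cardB := card_gab_generators K #|F| m k n.
have := generator_count (gbin_lt_wsum F1 k1 kn) ltTQ count.
rewrite -/T -/Q in cardS cardB *; have cardK : #|K| = Q := card_finExt.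
move=> lt_count.
have [|G GNB GNS] := exists_generator (B := B) scalS.
  rewrite cardK.
  (* The length is [n + 1], and [k * (n + 1) = (n - k) * (k - 1) + k * k + n]. Cancelling the common
     factor [X] reduces the union bound to [generator_count]. *)
  have eqX : (Q ^ (k * n.+1) = Q ^ ((n.+1 - k - 1) * (k - 1)) * (Q ^ (k * k) * Q ^ n))%N.
    rewrite -!expnD; congr (_ ^ _)%N.
    have [x defn] : exists x, n = (k + x.+1)%N by exists (n - k.+1)%N; lia.
    have [y defk] : exists y, k = y.+1 by exists k.-1; lia.
    rewrite defn (_ : (k + x.+1).+1 - k - 1 = x.+1)%N; last by lia.
    rewrite defk subn1 /=; nia.
  have eqY : (Q ^ k * (Q ^ (n.+1 - k) * Q ^ (k.-1 * n.+1)) = Q ^ (k * n.+1))%N.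
    by rewrite -!expnD addnA subnKC // -mulSn prednK // ltnW.
  set X := (Q ^ (k * k) * Q ^ n)%N in eqX.
  have X0 : (0 < X)%N by rewrite muln_gt0 !expn_gt0; lia.
  set W := (Q ^ ((n.+1 - k - 1) * (k - 1)))%N in eqX lt_count.
  apply: (@leq_ltn_trans ((gbin #|F| n.+1 k * W + Q.-1 * (m - 1)) * X)); last first.
    by rewrite eqX [ltnRHS]mulnA ltn_pmul2r.
  rewrite mulnDl leq_add //.
    rewrite -mulnA -eqX -eqY [leqRHS]mulnCA leq_mul2l; apply/orP; right.
    rewrite [leqRHS]mulnA leq_mul2r; apply/orP; right.
    by rewrite -cardK.
  rewrite -mulnA leq_mul2l; apply/orP; right.
  apply: leq_trans cardB _; rewrite cardK subn1 /X; apply: eq_leq.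
  by rewrite mulnCA.
have rkG (x : 'rV[L]_k) : x != 0 -> (n.+1 - k < rk (x *m (G : 'M[L]_(k, n.+1))))%N.
  move=> x0; rewrite ltnNge; apply: contra GNS => xS.
  by apply/existsP; exists x; rewrite x0 inE.
have k0 : (0 < k <= n.+1)%N by rewrite lekn andbT ltnW.
have [dimC mrdC] := row_span_MRD k0 rkG.
exists <<[tuple row i (G : 'M[L]_(k, n.+1)) | i < k]>>%VS; split=> // gabC.
by move/negP: GNB; apply; apply: gab_code_generators.
Qed.

End Main.

Lemma good_bound_of_ineq (F : finFieldType) (k n M : nat) :
  (1 < k)%N -> (k.+1 < n)%N -> bound_ineq #|F| k n M -> good_bound F k n M.
Proof.
move=> k1 kn bM m leMm L dimL.
have [] := bound_ineq_nat (finNzRing_gt1 F) k1 kn bM leMm.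
by rewrite -dimL; apply: exists_MRD_not_gabidulin.
Qed.

Theorem theorem4p12 (F : finFieldType) (k n : nat) :
  (1 < k)%N -> (k < n - 1)%N ->
  (exists M : nat, good_bound F k n M) /\
  (forall M0 : nat,
     bound_ineq #|F| k n M0 ->
     (forall m : nat, bound_ineq #|F| k n m -> (M0 <= m)%N) ->
     good_bound F k n M0).
Proof.
move=> k1; rewrite ltn_subRL add1n => kn; split=> [|M0 bM0 _].
  have [M bM] := bound_ineq_ex (finNzRing_gt1 F) k1 kn.
  by exists M; apply: good_bound_of_ineq.
exact: good_bound_of_ineq.
Qed.
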